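(* Let $(M,g)$ be a smooth, connected, compact Riemannian manifold with Riemannian distance $d$, and let $W(x,y)=h(d(x,y)^2)$ where $h:[0,\infty)\to\mathbb{R}$ satisfies $h(0)=0$ and $h\in C^1([0,\operatorname{diam}(M)^2])\cap C^2_{loc}((0,\operatorname{diam}(M)^2))$. Let $L:=2\operatorname{Lip}(h)\operatorname{diam}(M)$ and assume $L>0$. Given $\tau>0$ and $\mu_k^\tau\in\mathcal{P}_2(M)$, if $$\mu_{k+1}^\tau\in\operatorname{argmin}_{\rho\in\mathcal{P}_2(M)}\left\{\frac12\int_M\int_M W(x,y)\,d\rho(x)\,d\rho(y)+\frac{1}{2\tau}d_2(\mu_k^\tau,\rho)^2\right\},$$ then $$\operatorname{spt}(\mu_{k+1}^\tau)\subseteq\{x\in M: d(x,\operatorname{spt}(\mu_k^\tau))\le L\tau\}.$$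
   Context: $\mathcal{P}_2(M)$ is the set of Borel probability measures on $M$ with finite second moment, $d_2$ is the Wasserstein-2 metric on it (built from $d$), and $\operatorname{spt}$ denotes the support. $\operatorname{Lip}(h)$ is the Lipschitz constant of $h$ on $[0,\operatorname{diam}(M)^2]$, so $L$ is a Lipschitz constant of $x\mapsto W(x,y)$ for every $y\in M$. *)

(* Defs.v *)
From HB Require Import structures.
From mathcomp Require Import all_boot all_order all_algebra.
From mathcomp Require Import all_classical all_reals all_analysis.

Set Implicit Arguments.
Unset Strict Implicit.
Unset Printing Implicit Defensive.

Import Order.TTheory GRing.Theory Num.Theory.
Import numFieldNormedType.Exports.

Local Open Scope classical_set_scope.
Local Open Scope ring_scope.

(* The Borel sigma-algebra below is only available on pointed types. *)
#[short(type="pmetricType")]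
HB.structure Definition PointedMetric (K : numDomainType) :=
  { M of Metric K M & isPointed M }.

Section Differentiability.
Context {R : realType}.

(* [f] is of class C^k on the open set [U]; in finite dimension, the derivative
   of [f] is C^k exactly when all the directional derivatives of [f] are. *)
Fixpoint Ck {V W : normedModType R} (k : nat) (U : set V) (f : V -> W) : Prop :=
  match k with
  | 0 => forall x, U x -> {for x, continuous f}
  | k'.+1 => (forall x, U x -> differentiable f x) /\
             (forall v, Ck k' U ('D_v f))
  end.

Definition smooth {V W : normedModType R} (U : set V) (f : V -> W) : Prop :=
  forall k, Ck k U f.

(* C^1 on the closed interval [a, b], with one-sided derivatives at a and b. *)
Definition C1_closed (a b : R) (h : R -> R) : Prop :=
  exists h' : R -> R,
    {within `[a, b]%classic, continuous h'} /\
    (forall t, t \in `[a, b] ->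
      (fun s => (h s - h t) / (s - t)) @ within `[a, b]%classic t^' --> h' t).

Definition lip_const (A : set R) (h : R -> R) : R :=
  inf [set k : R | 0 <= k /\ k.-lipschitz_A h].

End Differentiability.

Section Manifold.
Context {R : realType}.

Record chart (n : nat) (M : topologicalType) := Chart {
  chart_fun :> M -> 'rV[R]_n;
  chart_inv : 'rV[R]_n -> M;
  chart_dom : set M;
  chart_cod : set 'rV[R]_n;
  chart_dom_open : open chart_dom;
  chart_cod_open : open chart_cod;
  chart_funS : forall p, chart_dom p -> chart_cod (chart_fun p);
  chart_invS : forall x, chart_cod x -> chart_dom (chart_inv x);
  chart_funK : forall p, chart_dom p -> chart_inv (chart_fun p) = p;
  chart_invK : forall x, chart_cod x -> chart_fun (chart_inv x) = x;
  chart_fun_cont : forall p, chart_dom p -> {for p, continuous chart_fun};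
  chart_inv_cont : forall x, chart_cod x -> {for x, continuous chart_inv} }.

Definition transition {n} {M : topologicalType} (c1 c2 : chart n M) :
    'rV[R]_n -> 'rV[R]_n :=
  c2 \o chart_inv c1.

Definition transition_dom {n} {M : topologicalType} (c1 c2 : chart n M) :
    set 'rV[R]_n :=
  chart_cod c1 `&` chart_inv c1 @^-1` chart_dom c2.

Record smooth_atlas (n : nat) (M : topologicalType) := SmoothAtlas {
  atlas : set (chart n M);
  atlas_cover : forall p, exists2 c, atlas c & chart_dom c p;
  atlas_smooth : forall c1 c2, atlas c1 -> atlas c2 ->
    smooth (transition_dom c1 c2) (transition c1 c2) }.

Definition inner {n} (G : 'M[R]_n) (u v : 'rV[R]_n) : R := (u *m G *m v^T) 0 0.

(* [metric_mx c x] is the matrix, in the coordinates of the chart [c], of the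
   inner product on the tangent space at the point of coordinates [x]. *)
Record riemannian_metric (n : nat) (M : topologicalType)
    (A : smooth_atlas n M) := RiemannianMetric {
  metric_mx : chart n M -> 'rV[R]_n -> 'M[R]_n;
  metric_smooth : forall c, atlas A c -> smooth (chart_cod c) (metric_mx c);
  metric_sym : forall c x u v, atlas A c -> chart_cod c x ->
    inner (metric_mx c x) u v = inner (metric_mx c x) v u;
  metric_pos : forall c x v, atlas A c -> chart_cod c x -> v != 0 ->
    0 < inner (metric_mx c x) v v;
  metric_transition : forall c1 c2 x u v, atlas A c1 -> atlas A c2 ->
    transition_dom c1 c2 x ->
    inner (metric_mx c1 x) u v =
    inner (metric_mx c2 (transition c1 c2 x))
      ('d (transition c1 c2) x u) ('d (transition c1 c2) x v) }.

Section Length.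
Context {n : nat} {M : topologicalType} (A : smooth_atlas n M)
  (g : riemannian_metric A).

Definition C1_at (gamma : R -> M) (t : R) : Prop :=
  {for t, continuous gamma} /\
  (forall c, atlas A c -> chart_dom c (gamma t) ->
    (\forall s \near t, derivable (c \o gamma) s 1) /\
    {for t, continuous ((c \o gamma)^`())%classic}).

(* Each closed piece is the restriction of a curve which is C^1 up to the
   endpoints; as consecutive pieces share a breakpoint, [gamma] is continuous
   on [a, b]. *)
Definition piecewise_C1 (gamma : R -> M) (a b : R) : Prop :=
  exists (k : nat) (t : nat -> R),
    [/\ t 0%N = a, t k = b &
      forall i, (i < k)%N -> t i < t i.+1 /\
        exists sigma : R -> M,
          forall s, s \in `[t i, t i.+1] -> sigma s = gamma s /\ C1_at sigma s].

Definition chart_at (p : M) : chart n M := s2val (cid2 (atlas_cover A p)).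

(* The norm of the velocity does not depend on the chart; its value at the
   finitely many breakpoints is irrelevant to the length. *)
Definition speed (gamma : R -> M) (t : R) : R :=
  let c := chart_at (gamma t) in
  let v := ((c \o gamma)^`())%classic t in
  Num.sqrt (inner (metric_mx g c (c (gamma t))) v v).

Definition curve_length (gamma : R -> M) (a b : R) : \bar R :=
  (\int[lebesgue_measure]_(t in `[a, b]) (speed gamma t)%:E)%E.

Definition riemannian_dist (p q : M) : \bar R :=
  ereal_inf [set l | exists (gamma : R -> M) (a b : R),
    [/\ piecewise_C1 gamma a b, gamma a = p, gamma b = q &
        l = curve_length gamma a b]].

End Length.

(* The distance of a Riemannian manifold induces its topology, so a Riemannian
   manifold can be presented as a metric space whose distance is [mdist]. *)
Definition is_riemannian_distance {n} {M : metricType R}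
    {A : smooth_atlas n M} (g : riemannian_metric A) : Prop :=
  forall p q : M, (mdist p q)%:E = riemannian_dist g p q.

End Manifold.

Notation borel M := (g_sigma_algebraType (@open M)).

Section Wasserstein.
Context {R : realType} {M : pmetricType R}.
Implicit Types (mu nu rho : probability (borel M) R).

Definition diam : R := sup [set mdist p.1 p.2 | p in [set: M * M]].

(* As usual, the distance to the empty set is infinite. *)
Definition dist_to_set (x : M) (A : set M) : \bar R :=
  ereal_inf [set (mdist x a)%:E | a in A].

Definition P2 : set (probability (borel M) R) :=
  [set mu | exists x0 : M,
     (\int[mu]_x ((mdist x0 (x : borel M)) ^+ 2)%:E < +oo)%E].

Definition spt mu : set M :=
  [set x | forall U : set M, open U -> U x -> (0 < mu U)%E].

(* The product sigma-algebra is the Borel one of the product space when M is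
   second countable, in particular when M is compact. *)
Definition coupling mu nu :
    set (probability (borel M * borel M)%type R) :=
  [set pi | forall B : set (borel M), measurable B ->
     pi (B `*` setT) = mu B /\ pi (setT `*` B) = nu B].

Definition wasserstein2 mu nu : \bar R :=
  (ereal_inf
     [set \int[pi]_z ((mdist ((z : borel M * borel M).1 : M) z.2) ^+ 2)%:E
     | pi in coupling mu nu] `^ 2^-1)%E.

Definition interaction_energy (W : M -> M -> R) rho : \bar R :=
  ((2^-1)%:E * \int[rho]_y \int[rho]_x (W (x : borel M) (y : borel M))%:E)%E.

Definition jko_functional (W : M -> M -> R) (tau : R) mu rho : \bar R :=
  (interaction_energy W rho + ((2 * tau)^-1)%:E * wasserstein2 mu rho ^+ 2)%E.

Definition argmin {T : Type} (S : set T) (F : T -> \bar R) : set T :=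
  [set r | S r /\ forall s, S s -> (F r <= F s)%E].

End Wasserstein.

Arguments diam {R} M.
Arguments P2 {R} M.

(* Main.v *)
(* Suppose some p in spt mu' has d(p, y) >= q > L tau for all y in spt mu. Take
   a nearly optimal coupling of mu and mu', and move the mass sitting within r
   of p by about e towards the points of spt mu it is coupled with. If m is the
   mass of the ball, the interaction energy grows by at most L (e + r) m, since W
   is L-Lipschitz in each variable, while the transport term decreases by about
   2 e q m / (2 tau) > L e m; for r << e << 1 this contradicts minimality.
   Covering spt mu by finitely many balls of radius r makes the displacement
   simple in the coupled point, so that neither measurable selections of
   geodesics nor the existence of optimal plans is needed. The only property of
   the Riemannian distance involved is that it is a length metric. *)

From HB Require Import structures.
Require Import Defs.
From mathcomp Require Import all_boot all_order all_algebra.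
From mathcomp Require Import all_classical all_reals all_analysis.
From mathcomp Require Import finmap measurable_realfun ring lra.
Import Order.TTheory GRing.Theory Num.Theory.
Import numFieldNormedType.Exports.
Local Open Scope classical_set_scope.
Local Open Scope ring_scope.

Set Implicit Arguments.
Unset Strict Implicit.
Unset Printing Implicit Defensive.

(** * Superadditivity of the integral over almost disjoint sets *)

Section LowerIntegral.
Import HBNNSimple.

(* [f] need not be measurable: the integral of a nonnegative function is a
   supremum over the simple functions below it. *)
Lemma integral_superadd d (T : measurableType d) (R : realType)
    (mu : {measure set T -> \bar R}) (A B D : set T) (f : T -> \bar R) :
    measurable A -> measurable B -> measurable D ->
    (forall x, (0 <= f x)%E) ->
    mu (A `&` B) = 0%E -> A `|` B `<=` D ->
  (\int[mu]_(x in A) f x + \int[mu]_(x in B) f x <= \int[mu]_(x in D) f x)%E.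
Proof.
move=> mA mB mD f0 AB0 ABD.
rewrite !ge0_integralE//.
set I := (X in (_ <= X)%E).
set S1 := (X in (ereal_sup X + _)%E); set S2 := (X in (_ + ereal_sup X)%E).
have I0 : (0 <= I)%E.
  apply: ereal_sup_ubound; exists nnsfun0; last exact: sintegral0.
  by move=> x /=; rewrite /patch; case: ifP.
have [->|Iy] := eqVneq I +oo%E; first exact: leey.
have Ifin : I \is a fin_num by rewrite ge0_fin_numE// ltey.
have key (h1 h2 : {nnsfun T >-> R}) : (forall x, (h1 x)%:E <= (f \_ A) x)%E ->
    (forall x, (h2 x)%:E <= (f \_ B) x)%E ->
    (sintegral mu h1 + sintegral mu h2 <= I)%E.
  move=> H1 H2.
  (* [h2] is cut off [A], so that the sum stays below [f] on the overlap. *)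
  pose h2' := proj_nnsfun h2 (measurableC mA).
  (* Off [B], [h2] is squeezed between [0] and [0], so the cut changes it only on the null set [A]
     meets [B]. *)
  have -> : sintegral mu h2 = sintegral mu h2'.
    have E (h : {nnsfun T >-> R}) : sintegral mu h = (\int[mu]_x (h x)%:E)%E.
      by rewrite integral_nnsfun// patch_setT.
    rewrite !E; apply: ae_eq_integral => //.
    - exact/measurable_EFinP.
    - exact/measurable_EFinP.
    - exists (A `&` B); split => //; first exact: measurableI.
      move=> x /= /not_implyP[_].
      rewrite /= /mindic indicE.
      have [xA|xA] := boolP (x \in A).
        have [xB _|xB] := boolP (x \in B); first by split; exact/set_mem.
        move: (H2 x); rewrite /patch (negbTE xB) lee_fin => h20.
        have -> : h2 x = 0 by apply/eqP; rewrite eq_le h20 fun_ge0.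
        by rewrite mul0r.
      by rewrite in_setC xA mulr1.
  rewrite -sintegralD; apply: ereal_sup_ubound => /=.
  exists (add_nnsfun h1 h2') => // x /=.
  move: (H1 x) (H2 x); rewrite /mindic indicE in_setC /patch.
  have sub : (x \in A) || (x \in B) -> x \in D.
    by move=> /orP[] /set_mem xx; apply/mem_set/ABD; [left|right].
  case: (boolP (x \in A)) sub => xA sub.
    by rewrite sub// mulr0 addr0.
  rewrite mulr1 EFinD => h10 h2B.
  have -> : h1 x = 0 by apply/eqP; rewrite eq_le fun_ge0 andbT -lee_fin.
  rewrite add0e; apply: le_trans h2B _.
  case: (boolP (x \in B)) sub => xB sub; first by rewrite sub.
  by case: ifP.
have S1I : (ereal_sup S1 <= I)%E.
  apply: ge_ereal_sup => _ [h1 /= H1 <-].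
  have := key h1 nnsfun0 H1; rewrite sintegral0 adde0; apply.
  by move=> x /=; rewrite /patch; case: ifP.
have S10 : (0 <= ereal_sup S1)%E.
  apply: ereal_sup_ubound; exists nnsfun0; last exact: sintegral0.
  by move=> x /=; rewrite /patch; case: ifP.
have S1fin : ereal_sup S1 \is a fin_num.
  by rewrite ge0_fin_numE// (le_lt_trans S1I)// ltey.
(* The two suprema are removed one after the other by subtraction, which requires the term moved
   across to be finite. *)
rewrite -leeBrDl//; apply: ge_ereal_sup => _ [h2 /= H2 <-].
have h2I : (sintegral mu h2 <= I)%E.
  have := key nnsfun0 h2; rewrite sintegral0 add0e; apply => //.
  by move=> x /=; rewrite /patch; case: ifP.
have h2fin : sintegral mu h2 \is a fin_num.
  by rewrite ge0_fin_numE ?sintegral_ge0// (le_lt_trans h2I)// ltey.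
rewrite leeBrDl// -leeBrDr//; apply: ge_ereal_sup => _ [h1 /= H1 <-].
by rewrite leeBrDr//; exact: key.
Qed.

End LowerIntegral.

(** * Continuity of Lipschitz functions *)

Section Metric.
Context {R : realType} {M : metricType R}.

Lemma mdist_ler_dist (x y z : M) : `|mdist x y - mdist x z| <= mdist y z.
Proof.
have H1 := metric_triangle x y z; have H2 := metric_triangle x z y.
by rewrite (metric_sym z y) in H2; rewrite ler_norml; apply/andP; split; lra.
Qed.

Lemma lipschitz_mdist_continuous (f : M -> R) (k : R) :
  (forall x y, `|f x - f y| <= k * mdist x y) -> continuous f.
Proof.
move=> fk x; apply/cvgrPdist_lt => e e0.
(* The radius is divided by [|k| + 1] because [k] may be zero or negative. *)
have k1 : 0 < `|k| + 1 by rewrite ltr_wpDl.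
have /nbhs_ballP : exists2 r : R, 0 < r & ball x r `<=` [set y | `|f x - f y| < e].
  exists (e / (`|k| + 1)); first exact: divr_gt0.
  move=> y; rewrite ballEmdist/= ltr_pdivlMr// => xy.
  apply: le_lt_trans (fk x y) _; apply: le_lt_trans xy.
  rewrite mulrC ler_wpM2l ?mdist_ge0//.
  by rewrite (le_trans (ler_norm k))// lerDl.
by [].
Qed.

Lemma mdist_continuous (x : M) : continuous (mdist x).
Proof.
by apply: (@lipschitz_mdist_continuous _ 1) => y z; rewrite mul1r mdist_ler_dist.
Qed.

End Metric.

(** * The Riemannian distance is a length metric *)

Section Curves.
Context {R : realType} {n : nat} {M : metricType R} {A : @smooth_atlas R n M}
  (g : riemannian_metric A).
Implicit Types (gamma : R -> M).

(** The last clause of [piecewise_C1] with its breakpoints made explicit, so that a curve can be cut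
    inside a given piece. *)
Let pieces gamma (k : nat) (t : nat -> R) := forall i, (i < k)%N ->
  t i < t i.+1 /\ exists sigma : R -> M, forall s, s \in `[t i, t i.+1] ->
    sigma s = gamma s /\ C1_at A sigma s.

Lemma pieces_left gamma k t i s : pieces gamma k t -> (i < k)%N ->
  s \in `[t i, t i.+1] -> piecewise_C1 A gamma (t 0%N) s.
Proof.
move=> gt ik; rewrite in_itv/= => /andP[].
(* The case [s = t i] is apart: breakpoints increase strictly, so a piece from [t i] to [s] would
   not be allowed. *)
rewrite le_eqVlt => /predU1P[<- _|tis sti].
  by exists i, t; split => // j ji; apply: gt; exact: ltn_trans ji ik.
exists i.+1, (fun j => if (j <= i)%N then t j else s).
rewrite leq0n ltnn; split => // j; rewrite ltnS => ji; rewrite ji.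
have [tj [sigma sigmaP]] := gt j (leq_ltn_trans ji ik).
have [ji'|ij] := ltnP j i; first by split => //; exists sigma.
have /eqP ? : j == i by rewrite eqn_leq ji.
subst j; split => //; exists sigma => u; rewrite in_itv/= => /andP[u1 u2].
by apply: sigmaP; rewrite in_itv/= u1 (le_trans u2).
Qed.

Lemma pieces_right gamma k t i s : pieces gamma k t -> (i < k)%N ->
  s \in `[t i, t i.+1] -> piecewise_C1 A gamma s (t k).
Proof.
move=> gt ik; rewrite in_itv/= => /andP[tis].
rewrite le_eqVlt => /predU1P[->|sti].
  exists (k - i.+1)%N, (fun j => t (j + i.+1)%N); rewrite add0n subnK//; split => //.
  by move=> j; rewrite ltn_subRL addnC => jk; rewrite addSn; exact: gt.
exists (k - i)%N, (fun j => if j is 0 then s else t (j + i)%N); split => //.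
  case E : (k - i)%N => [|m]; first by move: ik; rewrite -subn_gt0 E.
  by rewrite -E subnK// ltnW.
case=> [_|j].
  rewrite add1n; split => //.
  have [_ [sigma sigmaP]] := gt i ik; exists sigma => u.
  rewrite in_itv/= => /andP[u1 u2].
  by apply: sigmaP; rewrite in_itv/= u2 (le_trans tis).
by rewrite ltn_subRL addnC => jk; exact: gt.
Qed.

Lemma pieces_itv_le gamma k t i : pieces gamma k t -> (i < k)%N ->
  t 0%N <= t i /\ t i.+1 <= t k.
Proof.
move=> gt ik.
have mono j l : (j <= l)%N -> (l <= k)%N -> t j <= t l.
  move=> jl; rewrite -(subnK jl); elim: (l - j)%N => // m IH.
  by rewrite addSn => mk; apply: le_trans (IH (ltnW mk)) _; apply/ltW; case: (gt _ mk).
by split; apply: mono => //; exact: ltnW.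
Qed.

(** The two intervals share only the null set [{s}]. Superadditivity suffices, so the measurability
    of [speed] never has to be discussed. *)
Lemma curve_length_split gamma (a b s : R) : a <= s <= b ->
  (curve_length g gamma a s + curve_length g gamma s b <=
   curve_length g gamma a b)%E.
Proof.
move=> /andP[as_ sb]; apply: integral_superadd => //.
- by move=> x; rewrite lee_fin sqrtr_ge0.
- rewrite (_ : _ `&` _ = [set s]); first exact: lebesgue_measure_set1.
  apply/seteqP; split => [x /= []|x /= ->]; rewrite !in_itv/=.
    by move=> /andP[_ xs] /andP[sx _]; apply/eqP; rewrite eq_le xs.
  by rewrite as_ sb !lexx.
- move=> x /= []; rewrite !in_itv/= => /andP[h1 h2]; apply/andP; split => //.
    exact: le_trans h2 sb.
  exact: le_trans as_ h1.
Qed.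

Hypothesis hd : is_riemannian_distance g.

Lemma mdist_le_curve_length gamma (a b : R) : piecewise_C1 A gamma a b ->
  ((mdist (gamma a) (gamma b))%:E <= curve_length g gamma a b)%E.
Proof.
by move=> gab; rewrite hd; apply: ereal_inf_lbound; exists gamma, a, b.
Qed.

(** On a curve from [x] to [y] of length less than [mdist x y + eta], some point is at distance [e]
    from [x] by the intermediate value theorem; the part before it has length at least [e], which
    bounds the part after it. *)
Lemma exists_between (x y : M) (e eta : R) : 0 < e < mdist x y -> 0 < eta ->
  exists2 z : M, mdist x z = e & mdist z y <= mdist x y - e + eta.
Proof.
move=> /andP[e0 exy] eta0.
have fin : riemannian_dist g x y \is a fin_num by rewrite -hd.
have [_ [gamma [a [b [gab ga gb ->]]]]] := lb_ereal_inf_adherent eta0 fin.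
rewrite -[ereal_inf _]/(riemannian_dist g x y) -hd -EFinD => len.
have [k [t [ta tb gt]]] := gab.
(* The first breakpoint at distance at least [e] is not [t 0], since [e > 0]; the piece ending there
   crosses the value [e]. *)
have [i ik /andP[ei ei1]] : exists2 i, (i < k)%N &
    mdist x (gamma (t i)) <= e <= mdist x (gamma (t i.+1)).
  have ex : exists i, e <= mdist x (gamma (t i)) by exists k; rewrite tb gb ltW.
  case: (ex_minnP ex) => -[|i] ei imin.
    by move: ei; rewrite ta ga mdistxx leNgt e0.
  exists i; last first.
    rewrite ei andbT ltW// ltNge; apply/negP => /imin; by rewrite ltnn.
  by apply: imin; rewrite tb gb ltW.
have [tii [sigma sigmaP]] := gt i ik.
have cont : {within `[t i, t i.+1], continuous (mdist x \o gamma)}.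
  apply: (@subspace_eq_continuous _ _ _ (mdist x \o sigma)).
    by move=> s /set_mem /= /sigmaP[/= -> _].
  apply: continuous_in_subspaceT => s /set_mem /= /sigmaP[_ [cs _]].
  by apply: continuous_comp => //; exact: mdist_continuous.
have [s sI xs] : exists2 s, s \in `[t i, t i.+1] & mdist x (gamma s) = e.
  apply: (IVT (ltW tii) cont) => /=.
  by rewrite ge_min ei le_max ei1 orbT.
have [t0i tik] := pieces_itv_le gt ik.
exists (gamma s) => //.
have as_ : a <= s <= b.
  move: sI; rewrite in_itv/= -ta -tb => /andP[h1 h2].
  by rewrite (le_trans t0i h1) (le_trans h2 tik).
have L1 := mdist_le_curve_length (pieces_left gt ik sI).
have L2 := mdist_le_curve_length (pieces_right gt ik sI).
rewrite ta ga xs in L1; rewrite tb gb in L2.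
have := le_lt_trans (le_trans (leeD L1 L2) (curve_length_split gamma as_)) len.
rewrite -EFinD lte_fin; lra.
Qed.

End Curves.

(** * Borel sets, measurability of the distance and covers of the support *)

Lemma second_countable_prod_open_measurable (M : ptopologicalType)
    (O : set (M * M)) :
  @second_countable M -> open O -> measurable (O : set (borel M * borel M)).
Proof.
move=> [B cB [Bo Bb]] oO.
(* Rectangles of basic open sets inside [O]: they exhaust [O] and are countably many, as the product
   sigma-algebra requires. *)
pose BB := [set C : set M * set M | [/\ B C.1, B C.2 & C.1 `*` C.2 `<=` O]].
have -> : O = \bigcup_(C in BB) (C.1 `*` C.2).
  apply/seteqP; split => [z Oz|z [C [_ _]]]; last exact.
  have [[P Q] /= [nP nQ] PQ] : nbhs z O by exact: open_nbhs_nbhs.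
  have [C1 [BC1 C1z] C1P] := Bb _ _ nP.
  have [C2 [BC2 C2z] C2Q] := Bb _ _ nQ.
  exists (C1, C2) => //; split => // t [t1 t2]; apply: PQ.
  by split; [exact: C1P|exact: C2Q].
have mBB C : BB C -> measurable ((C.1 `*` C.2) : set (borel M * borel M)).
  move=> [B1 B2 _]; apply: measurableX; apply: sub_sigma_algebra; exact: Bo.
have cBB : countable BB.
  apply: (@sub_countable _ _ _ (B `*` B)); last exact: countableX.
  by apply: subset_card_le => C [].
move: cBB => /pfcard_geP[->|[f]]; first by rewrite bigcup_set0.
rewrite -(image_eq f) bigcup_image; apply: bigcup_measurable => k _; apply: mBB.
exact: funS.
Qed.

Section BorelMetric.
Context {R : realType} {M : pmetricType R}.

Lemma open_borel (U : set M) : open U -> measurable (U : set (borel M)).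
Proof. exact: sub_sigma_algebra. Qed.

Lemma continuous_borel (f : M -> R) : continuous f ->
  measurable_fun [set: borel M] (f : borel M -> R).
Proof.
move=> cf; apply: (measurability _ (RGenOInfty.measurableE R)) => //.
move=> _ [_ [x ->] <-]; rewrite setTI; apply: open_borel.
by apply: open_comp => [y _|]; [exact: cf|rewrite set_itvE; exact: open_gt].
Qed.

Lemma open_mdist_lt (x : M) (r : R) : open [set y | mdist x y < r].
Proof.
apply: (@open_comp _ _ (mdist x) [set t | t < r]) => [y _|].
  exact: mdist_continuous.
exact: open_lt.
Qed.

(** Strict sublevel sets of the distance are open in the product; compactness gives second
    countability, hence their measurability for the product sigma-algebra. *)
Lemma measurable_mdist : compact [set: M] ->
  measurable_fun [set: borel M * borel M]
    (fun z : borel M * borel M => mdist (z.1 : M) (z.2 : M)).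
Proof.
move=> /compact_second_countable scM.
apply: (measurability _ (RGenInftyO.measurableE R)) => //.
move=> _ [_ [c ->] <-]; rewrite setTI.
apply: second_countable_prod_open_measurable => //.
rewrite openE => -[x y] /=; rewrite in_itv/= => xyc.
pose e := (c - mdist x y) / 2.
have e0 : 0 < e by rewrite divr_gt0// subr_gt0.
exists (ball x e, ball y e); first by split; exact: nbhsx_ballx.
move=> [x' y'] /= []; rewrite !ballEmdist/= in_itv/= => h1 h2.
have := metric_triangle x' x y'; have := metric_triangle x y y'.
rewrite (metric_sym x' x); move: h1 h2; rewrite /e; lra.
Qed.

(** Each point gets its ball of radius [r] if it lies in the support, and a null open neighbourhood
    otherwise. In a finite subcover, the null sets cover all that the balls miss. *)
Lemma spt_finite_cover (mu : probability (borel M) R) (r : R) :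
  compact [set: M] -> 0 < r -> exists s : seq M,
    (forall y, y \in s -> spt mu y) /\
    mu (~` \bigcup_(y in [set` s]) [set z | mdist y z < r]) = 0%E.
Proof.
move=> cM r0.
have H y : exists U : set M, [/\ open U, U y &
    if pselect (spt mu y) then U = [set z | mdist y z < r] else mu U = 0%E].
  case: pselect => [sy|Nsy].
    exists [set z | mdist y z < r]; split => //=; first exact: open_mdist_lt.
    by rewrite mdistxx.
  have [U /not_implyP[oU /not_implyP[Uy /negP]]] := (existsNP _).2 Nsy.
  rewrite -leNgt => U0; exists U; split => //.
  by apply/eqP; rewrite eq_le U0 measure_ge0.
have [f fP] := choice H.
move: cM; rewrite compact_cover => /(_ M setT f).
case=> [y _|y _|D _ Dc]; first by have [] := fP y.
  by exists y => //; have [] := fP y.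
exists [seq y <- enum_fset D | `[< spt mu y >]]; split.
  by move=> y; rewrite mem_filter => /andP[/asboolP].
set V := \bigcup_(y in _) _.
have mV : measurable (V : set (borel M)).
  by apply: open_borel; apply: bigcup_open => y _; exact: open_mdist_lt.
apply/measure_negligible; first exact: measurableC.
apply: (@negligibleS _ (borel M) R mu
    (\big[setU/set0]_(y <- enum_fset D | ~~ `[< spt mu y >]) f y)).
  rewrite -bigcup_seq_cond => y Vy.
  have [z Dz fzy] := Dc y I; exists z => //=; rewrite Dz /=.
  apply/asboolPn => sz; apply: Vy.
  have [_ _] := fP z; case: pselect => // spz fz.
  by exists z; [rewrite /= mem_filter Dz andbT; exact/asboolP|rewrite -fz].
apply: big_ind => [|A B|y /asboolPn sy].
- exact: negligible_set0.
- exact: negligibleU.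
- have [oy _] := fP y; case: pselect => // spy fy.
  by exists (f y); split => //; exact: open_borel.
Qed.

End BorelMetric.

(** * Integrals of bounded functions against a probability *)

Section BoundedIntegrals.
Context d (T : measurableType d) (R : realType) (P : probability T R).

Lemma bounded_integrable (f : T -> R) (K : R) : measurable_fun setT f ->
  (forall x, `|f x| <= K) -> P.-integrable setT (EFin \o f).
Proof.
move=> mf fK; apply: measurable_bounded_integrable => //.
  by rewrite ltey_eq fin_num_measure.
exists K; split; first exact: num_real.
by move=> k Kk x _ /=; apply: le_trans (fK x) (ltW Kk).
Qed.

Lemma Rintegral_probability_cst (k : R) : \int[P]_x k = k.
Proof.
rewrite Rintegral_cst// -[X in fine X]/(P setT); have -> := probability_setT P.
by rewrite mulr1.
Qed.

Lemma EFin_Rintegral (f : T -> R) : P.-integrable setT (EFin \o f) ->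
  (\int[P]_x (f x)%:E)%E = (\int[P]_x f x)%:E.
Proof. by move=> If; rewrite fineK//; exact: integrable_fin_num. Qed.

(** Serves as the majorant for a quantity that changes by at most [k] on [U] and not at all
    elsewhere. *)
Lemma Rintegral_add_indic (f : T -> R) (k : R) (U : set T) :
  P.-integrable setT (EFin \o f) -> measurable U ->
  P.-integrable setT (EFin \o (fun x => f x + k * \1_U x)) /\
  \int[P]_x (f x + k * \1_U x) = \int[P]_x f x + k * fine (P U).
Proof.
move=> If mU.
have IU : P.-integrable setT (EFin \o (\1_U : T -> R)).
  apply: (bounded_integrable (K := 1)) => [|x]; first exact: measurable_indic.
  by rewrite indicE; case: (_ \in _); rewrite ?normr1 ?normr0.
have IkU : P.-integrable setT (EFin \o (fun x => k * \1_U x)).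
  by rewrite (_ : _ \o _ = (fun x => k%:E * (EFin \o \1_U) x)%E)//; exact: integrableZl.
split; first exact: (integrableD measurableT If IkU).
rewrite RintegralD//; congr (_ + _); rewrite RintegralZl//; congr (_ * _).
by rewrite /Rintegral integral_indic// setIT.
Qed.

Lemma Rintegral_pushforward d' (T' : measurableType d') (X : {mfun T >-> T'})
    (f : T' -> R) (K : R) : measurable_fun setT f -> (forall x, `|f x| <= K) ->
  \int[distribution P X]_y f y = \int[P]_z f (X z).
Proof.
move=> mf fK; rewrite /Rintegral integral_distribution//.
- exact/measurable_EFinP.
- rewrite (_ : _ \o _ = EFin \o (f \o X))//.
  apply: (bounded_integrable (K := K)) => [|x]; last exact: fK.
  exact: (measurableT_comp mf (measurable_funPT X)).
Qed.

End BoundedIntegrals.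

(** * Growth of the interaction energy under a displacement *)

Section Displacement.
Context {R : realType} {M : pmetricType R}.

Definition lipschitz_fun (L : R) (f : M -> R) :=
  forall x y, `|f x - f y| <= L * mdist x y.

(** Pointwise, [f (Y z)] exceeds [f (X z)] by at most [L * b] on [U] and by nothing off [U];
    integrate over the common space [Z]. *)
Lemma Rintegral_displacement d (Z : measurableType d) (P : probability Z R)
    (X Y : {mfun Z >-> borel M}) (U : set Z) (L b K : R) (f : M -> R) :
  measurable U -> 0 <= L ->
  (forall z, U z -> mdist (X z : M) (Y z) <= b) ->
  (forall z, ~ U z -> X z = Y z) ->
  lipschitz_fun L f -> (forall x, `|f x| <= K) ->
  \int[distribution P Y]_x f x <=
  \int[distribution P X]_x f x + L * b * fine (P U).
Proof.
move=> mU L0 XYU XYN fL fK.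
have mf : measurable_fun [set: borel M] (f : borel M -> R).
  by apply: continuous_borel; exact: lipschitz_mdist_continuous fL.
rewrite !(Rintegral_pushforward _ _ mf fK).
have IX : P.-integrable setT (EFin \o (fun z => f (X z))).
  apply: (bounded_integrable _ (K := K)) => //.
  exact: (measurableT_comp mf (measurable_funPT X)).
have IY : P.-integrable setT (EFin \o (fun z => f (Y z))).
  apply: (bounded_integrable _ (K := K)) => //.
  exact: (measurableT_comp mf (measurable_funPT Y)).
have [IXU <-] := Rintegral_add_indic (L * b) IX mU.
apply: le_Rintegral => // z _; rewrite indicE.
have [/set_mem zU|/negP zU] := boolP (z \in U).
  have := fL (Y z) (X z); rewrite ler_norml => /andP[_].
  have := ler_wpM2l L0 (XYU z zU); rewrite metric_sym mulr1; lra.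
by rewrite XYN ?mulr0 ?addr0// => /mem_set.
Qed.

Definition potential (W : M -> M -> R) (rho : probability (borel M) R) (y : M) : R :=
  \int[rho]_x W (x : borel M) y.

(** Integrating in [x] preserves the bounds on [W], so the potential is again an admissible test
    function and the energy is a real number. *)
Lemma interaction_energy_potential (W : M -> M -> R) (K L : R)
    (rho : probability (borel M) R) :
  (forall y, lipschitz_fun L (W^~ y)) -> (forall x, lipschitz_fun L (W x)) ->
  (forall x y, `|W x y| <= K) ->
  [/\ lipschitz_fun L (potential W rho),
      forall y, `|potential W rho y| <= K &
      interaction_energy W rho =
        (2^-1 * \int[rho]_y potential W rho (y : borel M))%:E].
Proof.
move=> WL1 WL2 WK.
have IW y : rho.-integrable setT (EFin \o (fun x : borel M => W x y)).
  apply: (bounded_integrable _ (K := K)) => //; apply: continuous_borel.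
  exact: lipschitz_mdist_continuous (WL1 y).
have cst_int := Rintegral_probability_cst rho.
have Icst (k : R) : rho.-integrable setT (EFin \o cst k).
  exact: finite_measure_integrable_cst.
have PL : lipschitz_fun L (potential W rho).
  move=> y y'; rewrite /potential -RintegralB//.
  rewrite ler_norml -[leLHS]cst_int -[X in _ && (_ <= X)]cst_int.
  have IB := integrableB measurableT (IW y) (IW y').
  by apply/andP; split;
    [apply: (le_Rintegral _ (Icst _) IB)|apply: (le_Rintegral _ IB (Icst _))] => // x _;
    have := WL2 x y y'; rewrite ler_norml => /andP[].
have PK y : `|potential W rho y| <= K.
  rewrite ler_norml -[leLHS]cst_int -[X in _ && (_ <= X)]cst_int.
  by apply/andP; split;
    [apply: (le_Rintegral _ (Icst _) (IW y))|apply: (le_Rintegral _ (IW y) (Icst _))] => // x _;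
    have := WK x y; rewrite ler_norml => /andP[].
split => //.
rewrite /interaction_energy EFinM; congr (_ * _)%E.
rewrite -EFin_Rintegral; last first.
  apply: (bounded_integrable _ (K := K)) => //; apply: continuous_borel.
  exact: lipschitz_mdist_continuous PL.
by apply: eq_integral => y _; rewrite -EFin_Rintegral.
Qed.

(** The two measures are exchanged one variable at a time: test functions [W x y] in [x] compare the
    potentials, and the potential of [rho] is itself a test function. Each exchange costs [k], and
    the factor [1/2] turns [2 * k] into [k]. *)
Lemma interaction_energy_displacement (W : M -> M -> R) (K L k : R)
    (rho rho' : probability (borel M) R) :
  (forall y, lipschitz_fun L (W^~ y)) -> (forall x, lipschitz_fun L (W x)) ->
  (forall x y, `|W x y| <= K) ->
  (forall f, lipschitz_fun L f -> (forall x, `|f x| <= K) ->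
     \int[rho']_(x in [set: borel M]) f x <=
     \int[rho]_(x in [set: borel M]) f x + k) ->
  (interaction_energy W rho' <= interaction_energy W rho + k%:E)%E.
Proof.
move=> WL1 WL2 WK H.
have [PL PK ->] := interaction_energy_potential rho WL1 WL2 WK.
have [PL' PK' ->] := interaction_energy_potential rho' WL1 WL2 WK.
rewrite -EFinD lee_fin.
have PP y : potential W rho' y <= potential W rho y + k.
  by apply: H => // x; exact: WK.
have mP (r : probability (borel M) R) :
    lipschitz_fun L (potential W r) -> (forall y, `|potential W r y| <= K) ->
    rho'.-integrable [set: borel M] (EFin \o (potential W r : borel M -> R)).
  move=> rL rK; apply: (bounded_integrable _ (K := K)) => //; apply: continuous_borel.
  exact: lipschitz_mdist_continuous rL.
have Ik : rho'.-integrable [set: borel M] (EFin \o cst k).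
  exact: finite_measure_integrable_cst.
have : \int[rho']_y potential W rho' (y : borel M) <=
    \int[rho']_y potential W rho (y : borel M) + k.
  rewrite -[X in _ + X](Rintegral_probability_cst rho').
  rewrite -RintegralD//; last exact: mP.
  apply: le_Rintegral => //; first exact: mP.
  exact: (integrableD measurableT (mP _ PL PK) Ik).
have := H _ PL PK; lra.
Qed.

End Displacement.

(** * The transport cost as a real infimum over couplings *)

Section Transport.
Context {R : realType} {M : pmetricType R}.
Implicit Types mu nu : probability (borel M) R.

Definition sqdist (z : borel M * borel M) : R := mdist (z.1 : M) z.2 ^+ 2.

Lemma coupling_product mu nu : coupling mu nu (mu \x nu)%E.
Proof.
move=> B mB; split; rewrite [LHS]product_measure1E//.
  exact: (etrans (congr1 (mule (mu B)) (probability_setT nu)) (mule1 _)).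
exact: (etrans (congr1 (mule^~ (nu B)) (probability_setT mu)) (mul1e _)).
Qed.

Lemma wasserstein2_sqr mu nu : (wasserstein2 mu nu ^+ 2)%E =
  ereal_inf [set \int[pi]_z (sqdist z)%:E | pi in coupling mu nu]%E.
Proof.
rewrite /wasserstein2 /sqdist; set I := ereal_inf _.
have I0 : (0 <= I)%E.
  apply: le_ereal_inf_tmp => _ [pi _ <-]; apply: integral_ge0 => z _.
  by rewrite lee_fin sqr_ge0.
case: I I0 => [r| |]//= r0; last by rewrite invr_eq0 pnatr_eq0/= mulyy.
by rewrite -EFinM -expr2 powR12_sqrt// sqr_sqrtr.
Qed.

Hypothesis cM : compact [set: M].
Variable D : R.
Hypothesis dD : forall x y : M, mdist x y <= D.

Lemma sqdist_le z : `|sqdist z| <= D ^+ 2.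
Proof.
rewrite ger0_norm ?sqr_ge0// ler_sqr ?nnegrE ?mdist_ge0//.
exact: le_trans (mdist_ge0 _ _) (dD z.1 z.2).
Qed.

Lemma measurable_sqdist : measurable_fun setT sqdist.
Proof. by apply: measurable_funX; exact: measurable_mdist. Qed.

(** The cost is bounded by [D ^+ 2] and the product measure is a coupling, so the infimum is a real
    number [w], approached by nearly optimal couplings. *)
Lemma wasserstein2_sqr_fin mu nu : exists w : R,
  [/\ (wasserstein2 mu nu ^+ 2)%E = w%:E,
      forall pi, coupling mu nu pi -> w <= \int[pi]_z sqdist z &
      forall eta, 0 < eta ->
        exists2 pi, coupling mu nu pi & \int[pi]_z sqdist z < w + eta].
Proof.
rewrite wasserstein2_sqr; set S := [set _ | _ in _].
have SE (pi : probability (borel M * borel M)%type R) :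
    (\int[pi]_z (sqdist z)%:E)%E = (\int[pi]_z sqdist z)%:E.
  exact: EFin_Rintegral (bounded_integrable _ measurable_sqdist sqdist_le).
have Sfin : ereal_inf S \is a fin_num.
  rewrite ge0_fin_numE.
    apply: le_lt_trans (ltry (\int[(mu \x nu)%E]_z sqdist z)).
    by apply: ereal_inf_lbound; exists (mu \x nu)%E; [exact: coupling_product|exact: SE].
  apply: le_ereal_inf_tmp => _ [pi _ <-]; apply: integral_ge0 => z _.
  by rewrite lee_fin sqr_ge0.
exists (fine (ereal_inf S)); split; first by rewrite fineK.
  move=> pi cpi; rewrite -lee_fin fineK// -SE.
  by apply: ereal_inf_lbound; exists pi.
move=> eta eta0; have [_ [pi cpi <-]] := lb_ereal_inf_adherent eta0 Sfin.
by rewrite SE -[X in (X + _)%E]fineK// -EFinD lte_fin; exists pi.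
Qed.

End Transport.

(** * Moving the mass near [p] towards the coupled points *)

Section Relocation.
Context {R : realType} {M : pmetricType R} (F : M -> M) (p : M) (r : R).
Implicit Types (s : seq M) (z : borel M * borel M).

(** When [z.2] is near [p], the first centre [y] of [s] near [z.1] decides the new position [F y]. A
    finite nest of conditionals is measurable for an arbitrary [F]. *)
Fixpoint relocate s z : borel M :=
  if s is y :: s' then
    if (mdist y (z.1 : M) < r) && (mdist p (z.2 : M) < r) then F y
    else relocate s' z
  else z.2.

Definition relocated s : set (borel M * borel M) :=
  (\bigcup_(y in [set` s]) [set x | mdist y x < r]) `*` [set x | mdist p x < r].

Lemma relocate_in s z : relocated s z ->
  exists y, [/\ y \in s, mdist y (z.1 : M) < r & relocate s z = F y].
Proof.
move=> [[y0 ys0 y0z] /= pz]; elim: s ys0 => //= y s IH ys0.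
have [yz|yz] := boolP (mdist y (z.1 : M) < r).
  by rewrite pz; exists y; rewrite inE eqxx.
have [|y1 [y1s y1z ->]] := IH; last by exists y1; rewrite inE y1s orbT.
by move: ys0; rewrite inE => /predU1P[yy|//]; rewrite -yy y0z in yz.
Qed.

Lemma relocate_out s z : ~ relocated s z -> relocate s z = z.2.
Proof.
elim: s => //= y s IH Nz; case: ifPn => [/andP[yz pz]|_].
  by exfalso; apply: Nz; split => //; exists y => //=; rewrite inE eqxx.
apply: IH => -[[y0 /= y0s y0z] pz]; apply: Nz; split => //.
by exists y0 => //=; rewrite inE y0s orbT.
Qed.

Lemma measurable_relocate s : measurable_fun setT (relocate s).
Proof.
have mlt y (f : borel M * borel M -> borel M) : measurable_fun setT f ->
    measurable_fun setT (fun z => mdist y (f z : M) < r).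
  move=> mf; apply: measurable_fun_ltr => //.
  by apply: (measurableT_comp _ mf); apply: continuous_borel; exact: mdist_continuous.
elim: s => [|y s IH] /=; first exact: measurable_snd.
apply: measurable_fun_ifT => //; apply: measurable_and; apply: mlt.
  exact: measurable_fst.
exact: measurable_snd.
Qed.

Lemma measurable_near s :
  measurable (\bigcup_(y in [set` s]) [set x | mdist y x < r] : set (borel M)).
Proof.
by apply: open_borel; apply: bigcup_open => y _; exact: open_mdist_lt.
Qed.

Lemma measurable_relocated s : measurable (relocated s).
Proof.
apply: measurableX; first exact: measurable_near.
by apply: open_borel; exact: open_mdist_lt.
Qed.

(** By the first marginal, almost every [z.1] is near a centre of [s]; the only remaining condition
    is on [z.2], whose law is [nu]. *)
Lemma coupling_relocated (mu nu : probability (borel M) R) s pi :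
  coupling mu nu pi ->
  mu (~` \bigcup_(y in [set` s]) [set x | mdist y x < r]) = 0%E ->
  pi (relocated s) = nu [set x | mdist p x < r].
Proof.
move=> cpi muV; set V := \bigcup_(y in _) _ in muV *.
set U := [set x | mdist p x < r].
have mU : measurable (U : set (borel M)) by apply: open_borel; exact: open_mdist_lt.
have mV : measurable (V : set (borel M)) := measurable_near s.
rewrite -(cpi U mU).2.
have -> : setT `*` U = relocated s `|` (~` V `*` U).
  apply/seteqP; split=> [z [_ Uz]|z [[_ Uz]|[_ Uz]]] //.
  by have [Vz|Vz] := pselect (V z.1); [left|right].
rewrite measureU; first last.
- by rewrite /relocated -/V -/U -setXI setICr set0X.
- by apply: measurableX => //; exact: measurableC.
- exact: measurable_relocated.
rewrite [X in (_ + X)%E](_ : _ = 0%E) ?adde0//.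
apply: (@subset_measure0 _ _ _ pi _ (~` V `*` setT)).
- by apply: measurableX => //; exact: measurableC.
- by apply: measurableX => //; exact: measurableC.
- by move=> z [].
- exact: (etrans (cpi _ (measurableC mV)).1 muV).
Qed.

End Relocation.

(** * Decrease of the transport cost *)

Section TransportGain.
Context {R : realType} {M : pmetricType R}.
Variables (cM : compact [set: M]) (D : R) (dD : forall x y : M, mdist x y <= D).
Variables (p : M) (q e r : R) (F : M -> M) (s : seq M).
Hypotheses (r4e : 4 * r < e)
  (qs : forall y, y \in s -> q <= mdist p y)
  (Fe : forall y, y \in s -> mdist p (F y) = e)
  (Fy : forall y, y \in s -> mdist (F y) y <= mdist p y - e + r).

Lemma mdist_relocate_le (z : borel M * borel M) : relocated p r s z ->
  mdist (z.2 : M) (relocate F p r s z) <= e + r.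
Proof.
move=> zs; have [y [ys _ ->]] := relocate_in F zs.
have [_ /= pz] := zs; have := Fe ys; have := metric_triangle (z.2 : M) p (F y).
by rewrite (metric_sym (z.2 : M) p); lra.
Qed.

(** With [a = e - 4 * r] and [b = q - 2 * r] this is [b ^+ 2 - (b - a) ^+ 2], the least decrease of
    the square of a distance that is at least [b] and is shortened by [a]. *)
Let c := 2 * (e - 4 * r) * (q - 2 * r) - (e - 4 * r) ^+ 2.

Lemma sqdist_relocate_le (z : borel M * borel M) : relocated p r s z ->
  sqdist (z.1, relocate F p r s z) <= sqdist z - c.
Proof.
move=> zs; have [y [ys yz ->]] := relocate_in F zs; have [_ /= pz] := zs.
rewrite /sqdist /c /=; set u := mdist _ (F y); set d := mdist _ _.
have u0 : 0 <= u by exact: mdist_ge0.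
have t1 : u <= mdist y z.1 + mdist (F y) y.
  by rewrite (metric_sym y) (metric_sym (F y)); exact: metric_triangle.
have t2 : mdist p y <= mdist p z.2 + (d + mdist y z.1).
  apply: le_trans (metric_triangle p z.2 y) _; rewrite lerD2l /d.
  rewrite (metric_sym (z.1 : M) z.2) (metric_sym y); exact: metric_triangle.
(* The error [4 * r] consists of [r] from [t1], [r] from the nearly shortest curve through [F y],
   and [2 * r] from [t2]. *)
have ud : u <= d - (e - 4 * r) by move: (Fy ys); lra.
have dq : q - 2 * r <= d by move: (qs ys); lra.
have : u ^+ 2 <= (d - (e - 4 * r)) ^+ 2.
  by rewrite ler_sqr ?nnegrE// (le_trans u0 ud).
have : (e - 4 * r) * (q - 2 * r) <= (e - 4 * r) * d.
  by rewrite ler_wpM2l// subr_ge0 ltW.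
rewrite sqrrB; lra.
Qed.

(** The new coupling is the image of [pi] under [(z.1, T z)]: the first marginal is kept and the
    cost drops by at least [c] on the relocated pairs. *)
Lemma coupling_relocate (mu nu : probability (borel M) R)
    (T : {mfun (borel M * borel M)%type >-> borel M})
    (pi : probability (borel M * borel M)%type R) :
  T =1 relocate F p r s -> coupling mu nu pi ->
  exists2 pi', coupling mu (distribution pi T) pi' &
    \int[pi']_z sqdist z <=
      \int[pi]_z sqdist z - c * fine (pi (relocated p r s)).
Proof.
move=> TE cpi.
have mS : measurable_fun setT (fun z : borel M * borel M => (z.1, T z)).
  by apply: measurable_fun_pair => //; exact: measurable_fst.
pose S : {mfun (borel M * borel M)%type >-> (borel M * borel M)%type} :=
  HB.pack (fun z : borel M * borel M => (z.1, T z))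
    (isMeasurableFun.Build _ _ _ _ _ mS).
exists (distribution pi S).
  move=> B mB; split; first exact: (cpi _ mB).1.
  change (pi (S @^-1` (setT `*` B)) = pi (T @^-1` B)); congr (pi _).
  by apply/seteqP; split => [z []|].
rewrite (Rintegral_pushforward _ _ (measurable_sqdist cM) (sqdist_le dD)) -mulNr.
have I1 := bounded_integrable pi (measurable_sqdist cM) (sqdist_le dD).
have [I2 <-] := Rintegral_add_indic (- c) I1 (measurable_relocated p r s).
apply: le_Rintegral => //.
  apply: (bounded_integrable _ (K := D ^+ 2)) => [|z]; last exact: sqdist_le.
  exact: (measurableT_comp (measurable_sqdist cM) mS).
move=> z _ /=; rewrite indicE TE.
have [/set_mem zs|/negP zs] := boolP (z \in relocated p r s).
  by rewrite mulr1; exact: sqdist_relocate_le.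
by rewrite mulr0 addr0 relocate_out// => /mem_set.
Qed.

End TransportGain.

(** * Choice of the scales *)

Lemma exists_scales {R : realFieldType} (P q : R) : 0 < P < q ->
  exists e r : R, [/\ 0 < e < q, 0 < r, 4 * r < e &
    2 * P * (e + r) < 2 * (e - 4 * r) * (q - 2 * r) - (e - 4 * r) ^+ 2].
Proof.
move=> /andP[P0 Pq]; have q0 : 0 < q by exact: lt_trans Pq.
(* For [r = 0] the gap reads [e < 2 * (q - P)], so this [e] leaves room. With [r = k * e], all
   losses divided by [e] add up to at most [4/5 * (q - P)], against [2 * (q - P)] available. *)
pose e := (q - P) / 2; pose k := (q - P) / (40 * q).
have kq : k * q = (q - P) / 40 by rewrite /k; field; rewrite gt_eqF.
have k0 : 0 < k by rewrite divr_gt0 ?subr_gt0// mulr_gt0.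
have k40 : k < 1 / 40 by rewrite -(ltr_pM2r q0) kq; lra.
have e0 : 0 < e by rewrite /e; lra.
exists e, (k * e); split; [by rewrite e0 /e; lra|exact: mulr_gt0| |].
  by rewrite mulrA -[ltRHS]mul1r ltr_pM2r//; lra.
have -> : 2 * P * (e + k * e) = e * (2 * P + 2 * (k * P)) by ring.
have -> : 2 * (e - 4 * (k * e)) * (q - 2 * (k * e)) - (e - 4 * (k * e)) ^+ 2 =
  e * (2 * q - 8 * (k * q) - 4 * (k * e) + 16 * (k * e) * k - e * (1 - 4 * k) ^+ 2).
  by ring.
rewrite ltr_pM2l//.
have kP : k * P <= (q - P) / 40 by rewrite -kq ler_pM2l// ltW.
have ke : k * e <= 1 / 40 * e by rewrite ler_pM2r// ltW.
have kek : 0 <= 16 * (k * e) * k by apply: mulr_ge0 (ltW k0); rewrite pmulr_rge0// ltW// mulr_gt0.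
have e1 : e * (1 - 4 * k) ^+ 2 <= e.
  by rewrite ler_piMr ?(ltW e0)// expr_le1//; lra.
rewrite kq; have eE : e = (q - P) / 2 by [].
lra.
Qed.

(** * Lipschitz constants and the diameter *)

Lemma lip_const_ge0 {R : realType} (A : set R) (h : R -> R) : 0 <= lip_const A h.
Proof.
rewrite /lip_const; set S := [set k | _].
have [S0|NS] := pselect (S !=set0); first by apply: lb_le_inf => // k [].
rewrite (_ : S = set0) ?inf0//; apply/seteqP; split => // k Sk.
by apply: NS; exists k.
Qed.

(** Positivity rules out an empty set of constants, whose infimum is [0] by default; otherwise the
    infimum is itself a Lipschitz constant. *)
Lemma lip_const_lipschitz {R : realType} (A : set R) (h : R -> R) :
  0 < lip_const A h ->
  forall s t, A s -> A t -> `|h s - h t| <= lip_const A h * `|s - t|.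
Proof.
rewrite /lip_const; set S := [set k | _] => S0 s t As At.
have [[k Sk]|NS] := pselect (S !=set0); last first.
  by move: S0; rewrite (_ : S = set0) ?inf0 ?ltxx//; apply/seteqP; split => // k Sk;
    apply: NS; exists k.
have [->|st] := eqVneq s t; first by rewrite !subrr normr0 mulr0.
have st0 : 0 < `|s - t| by rewrite normr_gt0 subr_eq0.
rewrite -ler_pdivrMr//; apply: lb_le_inf; first by exists k.
by move=> l [_ hl]; rewrite ler_pdivrMr//; exact: (hl (s, t)).
Qed.

(** Positivity rules out the default value [0] that [sup] takes on a set without supremum. *)
Lemma mdist_le_diam {R : realType} {M : pmetricType R} : 0 < diam M ->
  forall x y : M, mdist x y <= diam M.
Proof.
move=> D0 x y; have [hs|hs] := pselect (has_sup [set mdist z.1 z.2 | z in [set: M * M]]).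
  by apply: sup_ubound; [case: hs|exists (x, y)].
by move: D0; rewrite /diam sup_out ?ltxx.
Qed.

(** Factor the difference of the squared distances: their sum is at most [2 * D] and their
    difference at most [mdist y y']. *)
Lemma lipschitz_sqdist {R : realType} {M : pmetricType R} (h : R -> R)
    (D l : R) (W : M -> M -> R) :
  (forall x y : M, mdist x y <= D) -> 0 <= l ->
  (forall s t, `[0, D ^+ 2]%classic s -> `[0, D ^+ 2]%classic t ->
    `|h s - h t| <= l * `|s - t|) ->
  (forall x y, W x y = h (mdist x y ^+ 2)) ->
  forall x, lipschitz_fun (2 * l * D) (W x).
Proof.
move=> dD l0 hl WE x y y'; rewrite !WE.
have inD a b : `[0, D ^+ 2]%classic (mdist (a : M) b ^+ 2).
  rewrite /= in_itv/= sqr_ge0/= ler_sqr ?nnegrE ?mdist_ge0//.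
  exact: le_trans (mdist_ge0 _ _) (dD a b).
apply: le_trans (hl _ _ (inD x y) (inD x y')) _.
rewrite (_ : 2 * l * D = l * (2 * D)); last by ring.
rewrite -mulrA ler_wpM2l// subr_sqr normrM mulrC.
apply: ler_pM => //; last exact: mdist_ler_dist.
rewrite ger0_norm ?addr_ge0 ?mdist_ge0//.
by have := dD x y; have := dD x y'; lra.
Qed.

(** * The support estimate, by comparison with a competitor *)

Theorem proposition17 (R : realType) (n : nat) (M : pmetricType R)
  (A : smooth_atlas n M) (g : riemannian_metric A)
  (hd : is_riemannian_distance g)
  (hconn : connected [set: M]) (hcomp : compact [set: M])
  (h : R -> R) (h0 : h 0 = 0)
  (hC1 : C1_closed 0 (diam M ^+ 2) h)
  (hC2 : Ck 2 `]0, diam M ^+ 2[%classic h)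
  (W : M -> M -> R) (hW : forall x y, W x y = h (mdist x y ^+ 2))
  (L : R) (hL : L = 2 * lip_const `[0, diam M ^+ 2]%classic h * diam M)
  (hL0 : 0 < L)
  (tau : R) (htau : 0 < tau)
  (mu mu' : probability (borel M) R) (hmu : P2 M mu)
  (hmu' : argmin (P2 M) (jko_functional W tau mu) mu') :
  spt mu' `<=` [set x | (dist_to_set x (spt mu) <= (L * tau)%:E)%E].
Proof.
move=> p sp /=; rewrite leNgt; apply/negP => Pdist.
(* [q] is the distance from [p] to the support, or [L * tau + 1] if that distance is infinite. *)
have [q Pq qdist] : exists2 q, L * tau < q & (q%:E <= dist_to_set p (spt mu))%E.
  case: (dist_to_set p (spt mu)) Pdist => [d| |]//; first by exists d.
  by exists (L * tau + 1); rewrite ?ltrDl ?leey.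
have qp y : spt mu y -> q <= mdist p y.
  move=> sy; rewrite -lee_fin; apply: le_trans qdist _.
  by apply: ereal_inf_lbound; exists y.
set D := diam M in hL hC1 hC2 *; set l := lip_const _ h in hL.
have lge0 : 0 <= l by exact: lip_const_ge0.
(* From [0 < L] both factors [l] and [D] are positive, so neither is a default value. *)
have l0 : 0 < l.
  by rewrite lt_neqAle lge0 andbT; apply/eqP => l0;
    rewrite hL -l0 mulr0 mul0r ltxx in hL0.
have D0 : 0 < D by move: hL0; rewrite hL pmulr_rgt0// mulr_gt0.
have dD := mdist_le_diam D0.
have hl := lip_const_lipschitz l0.
have WL2 x : lipschitz_fun L (W x).
  by rewrite hL; exact: lipschitz_sqdist dD lge0 hl hW x.
have WL1 y : lipschitz_fun L (W^~ y).
  by move=> x x'; rewrite !hW !(metric_sym _ y) -!hW; exact: WL2.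
(* Since [W x x = h 0 = 0], the Lipschitz estimate also bounds [W]. *)
have WK x y : `|W x y| <= L * D.
  have := WL2 x y x; rewrite (hW x x) mdistxx expr0n/= h0 subr0 => /le_trans; apply.
  by rewrite ler_wpM2l// ltW.
have P0 : 0 < L * tau by exact: mulr_gt0.
have [e [r [/andP[e0 eq] r0 r4e gap]]] := exists_scales (introT andP (conj P0 Pq)).
have [s [ssub muV]] := spt_finite_cover mu hcomp r0.
(* [F y] is at distance [e] from [p], nearly on the way to [y]. Off the support its value is
   arbitrary, as the centres in [s] belong to the support. *)
have FH y : exists z : M, spt mu y -> mdist p z = e /\ mdist z y <= mdist p y - e + r.
  have [sy|nsy] := pselect (spt mu y); last by exists y.
  have [z pz zy] : exists2 z, mdist p z = e & mdist z y <= mdist p y - e + r.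
    apply: (exists_between hd) => //.
    by rewrite e0 (lt_le_trans eq)// qp.
  by exists z.
have [F FP] := choice FH.
pose T : {mfun (borel M * borel M)%type >-> borel M} :=
  HB.pack (relocate F p r s)
    (isMeasurableFun.Build _ _ _ _ _ (measurable_relocate F p r s)).
pose X : {mfun (borel M * borel M)%type >-> borel M} :=
  HB.pack (@snd (borel M) (borel M))
    (isMeasurableFun.Build _ _ _ _ _ measurable_snd).
pose U := [set x | mdist p x < r].
have oU : open U by exact: open_mdist_lt.
pose m := fine (mu' U).
have m0 : 0 < m.
  apply: fine_gt0; rewrite sp//=; last by rewrite /U /= mdistxx.
  by rewrite ltey_eq fin_num_measure//; exact: open_borel.
set c := 2 * (e - 4 * r) * (q - 2 * r) - (e - 4 * r) ^+ 2 in gap.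
have [w [wE _ wlt]] := wasserstein2_sqr_fin hcomp dD mu mu'.
(* The coupling may miss the optimum by less than the net gain: [c * m] on the transport cost, minus
   [2 * tau] times the energy increase [L * (e + r) * m]. *)
have eta0 : 0 < (c - 2 * (L * tau) * (e + r)) * m by rewrite mulr_gt0 ?subr_gt0.
have [pi cpi piw] := wlt _ eta0.
have piE : fine (pi (relocated p r s)) = m.
  by congr fine; exact: coupling_relocated cpi muV.
(* The competitor: the law of the relocated second coordinate under [pi]. *)
pose rho : probability (borel M) R := distribution pi T.
have qs y : y \in s -> q <= mdist p y by move=> /ssub; exact: qp.
have Fe y : y \in s -> mdist p (F y) = e by move=> /ssub /FP[].
have Fy y : y \in s -> mdist (F y) y <= mdist p y - e + r by move=> /ssub /FP[].
have [pi' cpi' pi'le] : exists2 pi', coupling mu rho pi' &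
    \int[pi']_z sqdist z <= \int[pi]_z sqdist z - c * m.
  by rewrite -piE; exact: (coupling_relocate (T := T) hcomp dD r4e qs Fy (fun=> erefl) cpi).
have [w' [w'E w'le _]] := wasserstein2_sqr_fin hcomp dD mu rho.
have rhoP2 : P2 M rho.
  exists point; have I0 : rho.-integrable setT
      (EFin \o (fun x : borel M => mdist point (x : M) ^+ 2)).
    apply: (bounded_integrable _ (K := D ^+ 2)) => [|x].
      by apply: measurable_funX; apply: continuous_borel; exact: mdist_continuous.
    exact: (sqdist_le dD (point, x)).
  by rewrite [X in (X < _)%E](EFin_Rintegral I0) ltry.
have Erho : (interaction_energy W rho <=
    interaction_energy W mu' + (L * (e + r) * m)%:E)%E.
  apply: (interaction_energy_displacement WL1 WL2 WK) => f fL fK.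
  have := Rintegral_displacement pi (X := X) (Y := T)
    (measurable_relocated p r s) (ltW hL0) _ _ fL fK.
  rewrite piE => /(_ (e + r)) H.
  apply: le_trans (H _ _) _.
  - by move=> z; exact: (mdist_relocate_le Fe).
  - by move=> z /(relocate_out F) zs; exact: esym zs.
  (* The law of [X] under [pi] is [mu'], by the second marginal. *)
  rewrite lerD2r le_eqVlt; apply/orP; left; apply/eqP; congr fine.
  apply: eq_measure_integral => B mB _; rewrite -[RHS](cpi B mB).2.
  by congr (pi _); apply/seteqP; split => [z|z []].
have [_ _ Emu'] := interaction_energy_potential mu' WL1 WL2 WK.
have := hmu'.2 rho rhoP2; rewrite /jko_functional wE w'E => Fle.
have := le_trans Fle (leeD2r _ Erho).
rewrite Emu' -!EFinM -!EFinD lee_fin -addrA lerD2l.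
rewrite -(ler_pM2l (_ : 0 < 2 * tau)) ?mulr_gt0//.
rewrite mulrDr !mulrA mulfV ?mul1r; last by rewrite gt_eqF ?mulr_gt0.
(* Minimality gives [w <= w' + 2 * tau * L * (e + r) * m], while the relocated coupling gives
   [w' < w - 2 * tau * L * (e + r) * m] by the choice of the tolerance for [pi]. *)
have := w'le _ cpi'; lra.
Qed.
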